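(* Let $M$ be a smooth manifold, $\tau\in\Omega^1(M)$, $\omega\in\Omega^2(M)$, and $r\ge 0$ an integer. Then $(\tau,\omega)$ is a doublet of class $2r+1$ if, and only if, $$\omega^{r+1}=0 \quad\text{and}\quad \tau\wedge\omega^r\neq 0$$ at every point of $M$.
   Context: The class of a pair $(\tau,\omega)$ at $x\in M$ is the codimension in $T_xM$ of $\operatorname{Ker}\tau_x\cap\operatorname{Ker}\omega_x$, where $\operatorname{Ker}\alpha_x=\{v\in T_xM\mid\iota_v\alpha_x=0\}$. The pair is called a doublet if its class is constant on $M$. $\omega^r$ denotes the exterior product of $r$ copies of $\omega$ (with $\omega^0=1$). *)

(* Defs.v *)
From HB Require Import structures.
From mathcomp Require Import all_boot all_order all_algebra perm.
From mathcomp Require Import all_classical all_reals all_analysis.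

Set Implicit Arguments.
Unset Strict Implicit.
Unset Printing Implicit Defensive.

Import Order.TTheory GRing.Theory Num.Theory.
Import numFieldNormedType.Exports.

Local Open Scope classical_set_scope.
Local Open Scope ring_scope.

Section SmoothMaps.
Context {R : realType} {V W : normedModType R}.

(* In finite dimension, f is C^k.+1 on an open set iff it is differentiable
   there and all its directional derivatives are C^k. *)
Fixpoint Ck (k : nat) (U : set V) (f : V -> W) : Prop :=
  match k with
  | 0 => forall x, U x -> {for x, continuous f}
  | k'.+1 => (forall x, U x -> differentiable f x) /\
             (forall v, Ck k' U (fun x => 'D_v f x))
  end.

Definition smooth_on (U : set V) (f : V -> W) : Prop := forall k, Ck k U f.

End SmoothMaps.

(* A homeomorphism from an open subset of M onto an open subset of R^n; the
   values of the map and of its inverse outside these sets are irrelevant. *)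
Record chart (R : realType) (n : nat) (M : topologicalType) := Chart {
  chart_dom : set M ;
  chart_cod : set 'rV[R]_n ;
  chart_map :> M -> 'rV[R]_n ;
  chart_inv : 'rV[R]_n -> M ;
  open_chart_dom : open chart_dom ;
  open_chart_cod : open chart_cod ;
  chart_mapS : forall x, chart_dom x -> chart_cod (chart_map x) ;
  chart_invS : forall y, chart_cod y -> chart_dom (chart_inv y) ;
  chart_mapK : forall x, chart_dom x -> chart_inv (chart_map x) = x ;
  chart_invK : forall y, chart_cod y -> chart_map (chart_inv y) = y ;
  chart_map_continuous : forall x, chart_dom x -> {for x, continuous chart_map} ;
  chart_inv_continuous : forall y, chart_cod y -> {for y, continuous chart_inv}
}.

Definition transition (R : realType) (n : nat) (M : topologicalType)
    (c d : chart R n M) : 'rV[R]_n -> 'rV[R]_n := d \o chart_inv c.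

(* The atlas is not required to be maximal: an atlas and the maximal atlas it
   generates have the same tangent spaces and the same smooth forms. *)
Record smoothManifold (R : realType) (n : nat) := SmoothManifold {
  carrier :> topologicalType ;
  manifold_hausdorff : hausdorff_space carrier ;
  manifold_second_countable : @second_countable carrier ;
  atlas_index : Type ;
  atlas : atlas_index -> chart R n carrier ;
  atlas_cover : forall x, exists i, chart_dom (atlas i) x ;
  atlas_smooth : forall i j,
    smooth_on (atlas i @` (chart_dom (atlas i) `&` chart_dom (atlas j)))
              (transition (atlas i) (atlas j))
}.

Section TangentSpace.
Context {R : realType} {n : nat} {M : smoothManifold R n}.
Implicit Type x : M.

Definition charts_at x := {i : atlas_index M | chart_dom (atlas i) x}.

Definition chart_of x (i : charts_at x) : chart R n M := atlas (sval i).

(* A tangent vector at x is a family of coordinate vectors, one for each chart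
   around x, that transform by the differentials of the transition maps. *)
Definition compatible x : {pred charts_at x -> 'rV[R]_n} := fun v =>
  `[< forall i j : charts_at x,
        v j = 'd (transition (chart_of i) (chart_of j)) (chart_of i x) (v i) >].

Record tangent x := Tangent {
  tcoord : charts_at x -> 'rV[R]_n ;
  tcoordP : tcoord \in @compatible x }.

HB.instance Definition _ x := [isSub for @tcoord x].
HB.instance Definition _ x := [Choice of tangent x by <:].

Fact compatible_submod x : submod_closed (@compatible x).
Proof.
split=> [|a u v /asboolP uP /asboolP vP]; apply/asboolP => i j.
  by rewrite linear0.
by rewrite /= linearP -uP -vP.
Qed.
HB.instance Definition _ x :=
  GRing.isSubmodClosed.Build R _ (@compatible x) (@compatible_submod x).
HB.instance Definition _ x :=
  [SubChoice_isSubLmodule of tangent x by <:].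

Fact transition_diff x (i j : charts_at x) :
  differentiable (transition (chart_of i) (chart_of j)) (chart_of i x).
Proof.
have [+ _] := @atlas_smooth _ _ M (sval i) (sval j) 1; apply.
by exists x => //; split; [exact: (svalP i)|exact: (svalP j)].
Qed.

Fact transition_mapE x (i j : charts_at x) :
  transition (chart_of i) (chart_of j) (chart_of i x) = chart_of j x.
Proof. by rewrite /transition/= chart_mapK//; exact: (svalP i). Qed.

Fact near_eq_diff (V W : normedModType R) (f g : V -> W) (a : V) :
  differentiable f a -> differentiable g a -> {near a, f =1 g} ->
  'd f a = 'd g a :> (V -> W).
Proof.
by move=> fa ga fg; apply/funext => v; rewrite -!deriveE//; exact: near_eq_derive.
Qed.

Fact near_diff_comp (U V W : normedModType R) (f : U -> V) (g : V -> W)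
    (h : U -> W) (a : U) (b : V) (v : U) :
  f a = b -> differentiable f a -> differentiable g b -> differentiable h a ->
  {near a, g \o f =1 h} -> 'd g b ('d f a v) = 'd h a v.
Proof.
move=> <- fa ga ha gfh.
rewrite -(near_eq_diff (differentiable_comp fa ga) ha gfh).
by rewrite (diff_comp fa ga).
Qed.

Fact transition_comp x (i j k : charts_at x) v :
  'd (transition (chart_of j) (chart_of k)) (chart_of j x)
     ('d (transition (chart_of i) (chart_of j)) (chart_of i x) v) =
  'd (transition (chart_of i) (chart_of k)) (chart_of i x) v.
Proof.
apply: near_diff_comp; [exact: transition_mapE|exact: transition_diff..|].
have xi : chart_dom (chart_of i) x := svalP i.
have xj : chart_dom (chart_of j) x := svalP j.
have /= cinv := @chart_inv_continuous _ _ _ (chart_of i) _ (chart_mapS xi).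
have : \forall y \near (chart_of i x),
    chart_dom (chart_of j) (chart_inv (chart_of i) y).
  apply: cinv; rewrite chart_mapK//.
  exact: (open_nbhs_nbhs (conj (open_chart_dom _) xj)).
by apply: filterS => y yj; rewrite /transition/= chart_mapK.
Qed.

Fact transition_id x (i : charts_at x) v :
  'd (transition (chart_of i) (chart_of i)) (chart_of i x) v = v.
Proof.
have xi : chart_dom (chart_of i) x := svalP i.
have -> : 'd (transition (chart_of i) (chart_of i)) (chart_of i x) =
          'd id (chart_of i x) :> (_ -> _).
  apply: near_eq_diff; [exact: transition_diff|exact: (@ex_diff _ _ _ _ _ _ _ (is_diff_id _))|].
  have : \forall y \near (chart_of i x), chart_cod (chart_of i) y.
    by apply: open_nbhs_nbhs; split; [exact: open_chart_cod|exact: chart_mapS].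
  by apply: filterS => y yi; rewrite /transition/= chart_invK.
by rewrite (@diff_val _ _ _ _ _ _ _ (is_diff_id _)).
Qed.

Fact of_chart_subproof x (i : charts_at x) (w : 'rV[R]_n) :
  (fun j : charts_at x =>
     'd (transition (chart_of i) (chart_of j)) (chart_of i x) w)
    \in @compatible x.
Proof.
apply/asboolP => j k.
exact: (esym (transition_comp i j k w)).
Qed.

(* The tangent vector at x whose coordinates in the chart i are w. *)
Definition of_chart x (i : charts_at x) (w : 'rV[R]_n) : tangent x :=
  Tangent (of_chart_subproof i w).

Fact of_chartK x (i : charts_at x) :
  cancel (@of_chart x i) (fun v => tcoord v i).
Proof. by move=> w; rewrite /= transition_id. Qed.

Fact tcoordK x (i : charts_at x) :
  cancel (fun v : tangent x => tcoord v i) (of_chart i).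
Proof.
case=> v vP; apply: val_inj; apply/funext => j /=.
by move/asboolP : vP => /(_ i j).
Qed.

Definition some_chart x : charts_at x :=
  let: exist i xi := cid (atlas_cover x) in exist _ i xi.

Fact tangent_vector_axiom x : Vector.axiom n (tangent x).
Proof.
exists (fun v => tcoord v (some_chart x)); first by [].
by exists (of_chart (some_chart x)); [exact: tcoordK|exact: of_chartK].
Qed.
HB.instance Definition _ x :=
  Lmodule_hasFinDim.Build R (tangent x) (tangent_vector_axiom x).

(* The coordinate vector d/dx^j of the chart i at x (0 off its domain). *)
Definition coordinate_vector (i : atlas_index M) x (j : 'I_n) : tangent x :=
  if pselect (chart_dom (atlas i) x) is left xi
  then of_chart (exist _ i xi) (delta_mx 0 j) else 0.

End TangentSpace.
Arguments tangent {R n M} x.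

Section MultilinearAlgebra.
Context {R : realType} {V : vectType R}.

Definition multilinear k (a : ('I_k -> V) -> R) : Prop :=
  forall (i : 'I_k) (v : 'I_k -> V), scalar (fun w => a [eta v with i |-> w]).

Definition alternating k (a : ('I_k -> V) -> R) : Prop :=
  forall (i j : 'I_k) (v : 'I_k -> V), i != j -> v i = v j -> a v = 0.

(* The normalization 1/(p! q!) makes this the sum over (p, q)-shuffles. *)
Definition wedge p q (a : ('I_p -> V) -> R) (b : ('I_q -> V) -> R) :
    ('I_(p + q) -> V) -> R :=
  fun v => (p`! * q`!)%:R^-1 * \sum_(s : 'S_(p + q))
    (-1) ^+ s * a (fun i => v (s (lshift q i))) * b (fun j => v (s (rshift p j))).

Fixpoint wedge_pow (w : ('I_2 -> V) -> R) (r : nat) : ('I_(r * 2) -> V) -> R :=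
  match r with
  | 0 => fun=> 1
  | r'.+1 => wedge w (@wedge_pow w r')
  end.

(* (v, u_0, ..., u_(k-1)) *)
Definition fcons k (v : V) (u : 'I_k -> V) : 'I_k.+1 -> V :=
  fun i => if unlift ord0 i is Some j then u j else v.

Definition contraction k (v : V) (a : ('I_k.+1 -> V) -> R) : ('I_k -> V) -> R :=
  fun u => a (fcons v u).

Definition ker_form k (a : ('I_k.+1 -> V) -> R) : set V :=
  [set v | contraction v a = 0].

(* The linear subspace with underlying set K; see vspace_of_setP. *)
Definition vspace_of_set (K : set V) : {vspace V} :=
  xget 0%VS [set U | forall v, v \in U <-> K v].

Definition codim (K : set V) : nat :=
  (\dim {: V} - \dim (vspace_of_set K))%N.

Lemma vspace_of_setP (K : set V) :
    K 0 -> (forall (c : R) u v, K u -> K v -> K (c *: u + v)) ->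
  forall v, v \in vspace_of_set K <-> K v.
Proof.
move=> K0 KP.
pose P d := `[< exists2 U : {vspace V}, \dim U = d & forall v, v \in U -> K v >].
have exP : exists d, P d.
  exists 0%N; apply/asboolP; exists 0%VS; first exact: dimv0.
  by move=> v; rewrite memv0 => /eqP ->.
have ubP d : P d -> (d <= \dim {: V})%N.
  by move=> /asboolP[U <- _]; exact/dimvS/subvf.
have [d /asboolP[U dU UK] maxd] := ex_maxnP exP ubP.
suff : [set U : {vspace V} | forall v, v \in U <-> K v] (vspace_of_set K) by [].
apply: (@xgetPex _ 0%VS); exists U => v; split; first exact: UK.
move=> Kv; rewrite memvE; have /subv_trans -> // : (<[v]> <= U + <[v]>)%VS.
  exact: addvSr.
have := maxd (\dim (U + <[v]>)) _; rewrite -dU => /(_ _) le_d.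
have /eqP <- : U == (U + <[v]>)%VS; last by [].
rewrite eqEdim addvSl/= le_d//; apply/asboolP; exists (U + <[v]>)%VS => // w.
move=> /memv_addP[u Uu [_ /vlineP[c ->] ->]].
by rewrite addrC; apply: KP => //; exact: UK.
Qed.

Lemma ker_form_submod k (a : ('I_k.+1 -> V) -> R) : multilinear a ->
  ker_form a 0 /\
  (forall (c : R) u v, ker_form a u -> ker_form a v -> ker_form a (c *: u + v)).
Proof.
move=> am.
have fconsE (w : V) (u : 'I_k -> V) : fcons w u = [eta fcons 0 u with ord0 |-> w].
  apply/funext => i; rewrite /fcons /=.
  by case: unliftP => [j|] ->; rewrite ?eqxx// eq_sym (negbTE (neq_lift _ _)).
have lin (c : R) u v t : a (fcons (c *: u + v) t) =
    c * a (fcons u t) + a (fcons v t).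
  by rewrite fconsE am -!fconsE.
split=> [|c u v ku kv]; apply/funext => t.
  have := lin (-1) 0 0 t; rewrite scaler0 addr0 mulN1r addNr.
  by rewrite /contraction => ->.
move: (congr1 (@^~ t) ku) (congr1 (@^~ t) kv); rewrite /contraction => au av.
by rewrite lin au av mulr0 addr0.
Qed.

End MultilinearAlgebra.
Arguments wedge_pow {R V} w r.

Section DifferentialForms.
Context {R : realType} {n : nat} (M : smoothManifold R n).

Record diff_form (k : nat) := DiffForm {
  form_at :> forall x : M, ('I_k -> tangent x) -> R ;
  form_multilinear : forall x, multilinear (@form_at x) ;
  form_alternating : forall x, alternating (@form_at x) ;
  form_smooth : forall (i : atlas_index M) (J : 'I_k -> 'I_n),
    smooth_on (chart_cod (atlas i)) (fun y : 'rV[R]_n =>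
      @form_at (chart_inv (atlas i) y) (fun l => coordinate_vector i _ (J l)))
}.

End DifferentialForms.
Arguments form_at {R n M k} _ x.
Arguments form_multilinear {R n M k} _ x.
Arguments form_alternating {R n M k} _ x.

Section Doublets.
Context {R : realType} {n : nat} {M : smoothManifold R n}.

Definition class_at (tau : diff_form M 1) (omega : diff_form M 2) (x : M) : nat :=
  codim (ker_form (tau x) `&` ker_form (omega x)).

Definition doublet_of_class (tau : diff_form M 1) (omega : diff_form M 2)
    (c : nat) : Prop :=
  forall x : M, class_at tau omega x = c.

End Doublets.

(* Main.v *)
Require Import Defs.
From HB Require Import structures.
From mathcomp Require Import all_boot all_order all_algebra perm.
From mathcomp Require Import all_classical all_reals all_analysis.
Import Order.TTheory GRing.Theory Num.Theory.
Import numFieldNormedType.Exports.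
Local Open Scope ring_scope.

(** The statement is pointwise linear algebra on a tangent space V, with
    a linear form t and an alternating bilinear form w.

    A form that vanishes as soon as one argument lies in a subspace K is zero
    when its degree exceeds the codimension of K ([alternating_eq0_codim]).
    Hence w^k is nonzero only if 2k is at most the codimension of Ker w, and
    t /\ w^r only if 2r + 1 is at most the class.

    Conversely, if w^(r+1) = 0 and w^r(u) is nonzero for some u, then Ker w is
    exactly the set of v that are w-orthogonal to u_1, ..., u_2r: for such a v
    and any y, the value w^(r+1)(v, y, u) is a nonzero multiple of
    w(v, y) w^r(u), because v can only be paired with y
    ([alt_sum_tensor_pow_fcons]). So Ker w has codimension 2r
    ([dim_ker_top_power]), and no symplectic basis has to be constructed.

    Both implications follow. The kernel of t lowers the dimension of Ker w
    by 0 or 1. If w^(r+1) = 0 and t /\ w^r is nonzero, then the class is at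
    most 2r + 1 by this remark and at least 2r + 1 by the degree. If the class
    is 2r + 1, let s be the largest exponent with w^s nonzero; the class is
    2s or 2s + 1, so s = r by parity and t does not vanish on Ker w. Choosing
    v in Ker w with t(v) nonzero, (t /\ w^r)(v, u) is a nonzero multiple of
    t(v) w^r(u).

    The computations use that w^r is, up to a power of 2, the alternating sum
    of the tensor power of w ([wedge_powE]); this reduces them to reindexing
    sums over symmetric groups. *)

(** * Alternating sums of tensor products *)

Section AlternatingSums.
Context {R : realType} {V : vectType R}.

Definition tensor {p q} (a : ('I_p -> V) -> R) (b : ('I_q -> V) -> R) :
    ('I_(p + q) -> V) -> R :=
  fun x => a (fun i => x (lshift q i)) * b (fun j => x (rshift p j)).

(** Left unnormalized, so that factorials are inverted only when a wedge
    product is rewritten as an alternating sum. *)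
Definition alt_sum {k} (a : ('I_k -> V) -> R) : ('I_k -> V) -> R :=
  fun x => \sum_(s : 'S_k) (-1) ^+ s * a (fun i => x (s i)).

Lemma wedgeE p q (a : ('I_p -> V) -> R) (b : ('I_q -> V) -> R) x :
  wedge a b x = (p`! * q`!)%:R^-1 * alt_sum (tensor a b) x.
Proof.
by rewrite /wedge; congr (_ * _); apply: eq_bigr => s _; rewrite mulrA.
Qed.

(** Reindex by right translation in the symmetric group. *)
Lemma alt_sum_perm k (a : ('I_k -> V) -> R) (s : 'S_k) x :
  alt_sum a (fun i => x (s i)) = (-1) ^+ s * alt_sum a x.
Proof.
rewrite /alt_sum [in RHS](reindex_inj (mulIg s)) mulr_sumr.
apply: eq_bigr => t _; rewrite odd_permM signr_addb mulrCA mulrA.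
rewrite -[X in _ = X * _]mulrA -signr_addb addbb mulr1.
by congr (_ * a _); apply/funext => i; rewrite permM.
Qed.

Lemma alt_sum_alternating k (a : ('I_k -> V) -> R) :
  Defs.alternating (alt_sum a).
Proof.
move=> i j v ij vij; have := alt_sum_perm _ a (tperm i j) v.
rewrite odd_tperm ij expr1 mulN1r => H.
have vE : (fun l => v (tperm i j l)) = v.
  by apply/funext => l; case: tpermP => [->|->|].
by move: H; rewrite vE => /eqP; rewrite -addr_eq0 -mulr2n mulrn_eq0 => /eqP.
Qed.

Lemma lshift_lift0 p q (i : 'I_p) :
  lshift q (lift ord0 i) = lift ord0 (lshift q i) :> 'I_(p.+1 + q).
Proof. exact: val_inj. Qed.

Lemma rshift_lift0 p q (j : 'I_q) :
  rshift p.+1 j = lift ord0 (rshift p j) :> 'I_(p.+1 + q).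
Proof. exact: val_inj. Qed.

(** The copy of S_q in S_(p + q) that fixes the first [p] indices, made by
    iterating [lift_perm] because this keeps track of the sign. *)
Fixpoint shift_perm p {q} (t : 'S_q) : 'S_(p + q) :=
  if p is p'.+1 then lift_perm ord0 ord0 (shift_perm p' t) else t.

Lemma odd_shift_perm p q (t : 'S_q) : odd_perm (shift_perm p t) = odd_perm t.
Proof. by elim: p => //= p IH; rewrite odd_lift_perm /= IH. Qed.

Lemma shift_perm_lshift p q (t : 'S_q) i :
  shift_perm p t (lshift q i) = lshift q i.
Proof.
elim: p i => [[]//|p IH] i /=.
case: (unliftP ord0 i) => [j|] ->.
  by rewrite lshift_lift0 lift_perm_lift IH.
have -> : lshift q ord0 = ord0 :> 'I_(p.+1 + q) by exact: val_inj.
by rewrite lift_perm_id.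
Qed.

Lemma shift_perm_rshift p q (t : 'S_q) j :
  shift_perm p t (rshift p j) = rshift p (t j).
Proof.
elim: p => [|p IH] /=; first by rewrite !(_ : forall i, rshift 0 i = i)//;
   move=> i; exact: val_inj.
by rewrite !rshift_lift0 lift_perm_lift IH.
Qed.

(** Alternating the right factor first is redundant: each permutation [t] of
    its arguments is absorbed, sign included, by translating the outer sum by
    [shift_perm p t], so each of the q! values of [t] contributes the same. *)
Lemma alt_sum_tensor p q (a : ('I_p -> V) -> R) (b : ('I_q -> V) -> R) x :
  alt_sum (tensor a (alt_sum b)) x = q`!%:R * alt_sum (tensor a b) x.
Proof.
transitivity (\sum_(t : 'S_q) alt_sum (tensor a b) x); last first.
  by rewrite sumr_const card_Sn mulr_natl.
rewrite /alt_sum /tensor.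
under eq_bigr do rewrite mulr_sumr mulr_sumr.
rewrite exchange_big; apply: eq_bigr => t _.
rewrite [RHS](reindex_inj (mulgI (shift_perm p t))).
apply: eq_bigr => s _; rewrite odd_permM odd_shift_perm signr_addb.
have -> : (fun i => x ((shift_perm p t * s)%g (lshift q i))) =
    (fun i => x (s (lshift q i))).
  by apply/funext => i; rewrite permM shift_perm_lshift.
have -> : (fun j => x ((shift_perm p t * s)%g (rshift p j))) =
    (fun j => x (s (rshift p (t j)))).
  by apply/funext => j; rewrite permM shift_perm_rshift.
by rewrite [a _ * _]mulrCA [LHS]mulrCA -[RHS]mulrA.
Qed.

Lemma alt_sumZ k (c : R) (a : ('I_k -> V) -> R) x :
  alt_sum (fun y => c * a y) x = c * alt_sum a x.
Proof. by rewrite /alt_sum mulr_sumr; apply: eq_bigr => s _; rewrite mulrCA. Qed.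

Fixpoint tensor_pow (w : ('I_2 -> V) -> R) (r : nat) : ('I_(r * 2) -> V) -> R :=
  match r with
  | 0 => fun=> 1
  | r'.+1 => tensor w (tensor_pow w r')
  end.

Lemma alt_sum_tensorZ p q (a : ('I_p -> V) -> R) (b : ('I_q -> V) -> R) c x :
  alt_sum (tensor a (fun y => c * b y)) x = c * alt_sum (tensor a b) x.
Proof.
rewrite -alt_sumZ; congr (alt_sum _ x).
by apply/funext => y; rewrite /tensor mulrCA.
Qed.

(** Closed form: an iterated wedge is a single alternating sum, where the
    factorials of the successive wedges cancel and each factor [w] leaves a 1/2. *)
Lemma wedge_powE (w : ('I_2 -> V) -> R) r :
  wedge_pow w r = fun x => (2^-1) ^+ r * alt_sum (tensor_pow w r) x.
Proof.
apply/funext; elim: r => [|r IH] x.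
  rewrite expr0 mul1r /alt_sum (bigD1 (1%g : 'S_0)) //= odd_perm1 mulr1 big1.
    by rewrite addr0.
  by move=> s /eqP[]; apply/permP => -[].
rewrite /= wedgeE.
have -> : wedge_pow w r = fun y => 2^-1 ^+ r * alt_sum (tensor_pow w r) y by apply/funext.
rewrite alt_sum_tensorZ alt_sum_tensor exprS natrM.
have fact_neq0 : (r * 2)`!%:R != 0 :> R by rewrite pnatr_eq0 -lt0n fact_gt0.
by rewrite invfM mulrACA mulKf.
Qed.

Lemma wedge_tensor_pow p (a : ('I_p -> V) -> R) (w : ('I_2 -> V) -> R) r x :
  wedge a (wedge_pow w r) x =
  p`!%:R^-1 * (2^-1) ^+ r * alt_sum (tensor a (tensor_pow w r)) x.
Proof.
rewrite wedgeE wedge_powE alt_sum_tensorZ alt_sum_tensor natrM.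
have fact_neq0 : (r * 2)`!%:R != 0 :> R by rewrite pnatr_eq0 -lt0n fact_gt0.
by rewrite invfM mulrACA mulKf.
Qed.

Lemma fcons0 k (v : V) (u : 'I_k -> V) : fcons v u ord0 = v.
Proof. by rewrite /fcons unlift_none. Qed.

Lemma fcons_lift k (v : V) (u : 'I_k -> V) i : fcons v u (lift ord0 i) = u i.
Proof. by rewrite /fcons liftK. Qed.

Lemma fcons_eta k (x : 'I_k.+1 -> V) : fcons (x ord0) (fun i => x (lift ord0 i)) = x.
Proof.
by apply/funext => i; case: (unliftP ord0 i) => [j|] ->;
  rewrite ?fcons0 ?fcons_lift.
Qed.

Lemma fcons_with k (v : V) (u : 'I_k -> V) :
  fcons v u = [eta fcons 0 u with ord0 |-> v].
Proof.
apply/funext => i /=; case: (unliftP ord0 i) => [j|] ->.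
  by rewrite !fcons_lift.
by rewrite fcons0.
Qed.

Lemma lift_perm00_surj k (s : 'S_k.+1) : s ord0 = ord0 ->
  exists t, s = lift_perm ord0 ord0 t.
Proof.
move=> s0.
have neq j : ord0 != s (lift ord0 j).
  by rewrite -{1}s0 (inj_eq perm_inj) neq_lift.
pose f j := odflt j (unlift ord0 (s (lift ord0 j))).
have fE j : lift ord0 (f j) = s (lift ord0 j).
  by rewrite /f; case: unliftP (neq j) => [//|->]; rewrite eqxx.
have f_inj : injective f.
  move=> i j ij; apply: (@lift_inj _ ord0); apply: (@perm_inj _ s).
  by rewrite -!fE ij.
exists (perm f_inj); apply/permP => i; case: (unliftP ord0 i) => [j|] ->.
  by rewrite lift_perm_lift permE fE.
by rewrite lift_perm_id.
Qed.

(** The permutations that fix 0 are those of the other indices. *)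
Lemma alt_sum_fix0 k (a : ('I_k.+1 -> V) -> R) v u :
  \sum_(s : 'S_k.+1 | s ord0 == ord0)
      (-1) ^+ s * a (fun i => fcons v u (s i)) =
  alt_sum (Defs.contraction v a) u.
Proof.
have lift_inj0 : injective (fun t : 'S_k => lift_perm ord0 ord0 t).
  move=> t t' /permP tt'; apply/permP => i.
  by apply: (@lift_inj _ ord0); rewrite -!(lift_perm_lift ord0 ord0) tt'.
pose A := [set lift_perm ord0 ord0 t | t : 'S_k]%SET.
rewrite (eq_bigl (fun s => s \in A)); last first.
  move=> s; apply/eqP/imsetP => [/lift_perm00_surj[t ->]|[t _ ->]].
    by exists t.
  by rewrite lift_perm_id.
rewrite big_imset /=; last by move=> ? ? _ _; exact: lift_inj0.
apply: eq_big => [t|t _]; first by rewrite inE.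
rewrite odd_lift_perm /=; congr (_ * a _).
apply/funext => i; case: (unliftP ord0 i) => [j|] ->.
  by rewrite lift_perm_lift !fcons_lift.
by rewrite lift_perm_id !fcons0.
Qed.

(** Expansion along a 1-form when only one term survives. It serves in two
    situations: [v] lies in the kernel of [b], or [a] vanishes on all of [u]. *)
Lemma alt_sum_tensor1 q (a : ('I_1 -> V) -> R) (b : ('I_q -> V) -> R) v u :
  (forall s : 'S_q.+1, s ord0 != ord0 ->
     tensor a b (fun i => fcons v u (s i)) = 0) ->
  alt_sum (tensor a b) (fcons v u) = a (fun=> v) * alt_sum b u.
Proof.
move=> a0; rewrite -alt_sumZ.
transitivity (alt_sum (Defs.contraction v (tensor a b : ('I_q.+1 -> V) -> R)) u).
  rewrite -alt_sum_fix0 /alt_sum.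
  rewrite [LHS](bigID (fun s : 'S_q.+1 => s ord0 == ord0)) /=.
  by rewrite addrC big1 ?add0r// => s s0; rewrite a0 ?mulr0.
congr (alt_sum _ u); apply/funext => y; rewrite /Defs.contraction /tensor.
congr (a _ * b _); apply/funext => i.
  by rewrite [lshift _ _](_ : _ = ord0) ?fcons0//; apply: val_inj; case: i => [[]].
by rewrite [rshift _ _](_ : _ = lift ord0 i) ?fcons_lift//; exact: val_inj.
Qed.

End AlternatingSums.

(** * Forms that vanish on a subspace *)

Section VanishingForms.
Context {R : realType} {V : vectType R}.

(** Replacing an argument affects one factor only. *)
Lemma tensor_multilinear p q (a : ('I_p -> V) -> R) (b : ('I_q -> V) -> R) :
  Defs.multilinear a -> Defs.multilinear b -> Defs.multilinear (tensor a b).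
Proof.
move=> am bm i v c u w; rewrite /tensor.
case: (split_ordP i) => j -> {i}.
- have lE t : (fun l => [eta v with lshift q j |-> t] (lshift q l)) =
              [eta (fun l => v (lshift q l)) with j |-> t].
    by apply/funext => l /=; rewrite eq_lshift.
  have rE t : (fun l => [eta v with lshift q j |-> t] (rshift p l)) =
              (fun l => v (rshift p l)).
    by apply/funext => l /=; rewrite eq_rlshift.
  by rewrite !lE !rE am mulrDl mulrA.
- have lE t : (fun l => [eta v with rshift p j |-> t] (lshift q l)) =
              (fun l => v (lshift q l)).
    by apply/funext => l /=; rewrite eq_lrshift.
  have rE t : (fun l => [eta v with rshift p j |-> t] (rshift p l)) =
              [eta (fun l => v (rshift p l)) with j |-> t].
    by apply/funext => l /=; rewrite eq_rshift.
  by rewrite !lE !rE bm mulrDr mulrCA.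
Qed.

Lemma tensor_pow_multilinear (w : ('I_2 -> V) -> R) r :
  Defs.multilinear w -> Defs.multilinear (tensor_pow w r).
Proof.
by move=> wm; elim: r => [[]//|r IH]; exact: tensor_multilinear.
Qed.

Lemma alt_sum_multilinear k (a : ('I_k -> V) -> R) :
  Defs.multilinear a -> Defs.multilinear (alt_sum a).
Proof.
move=> am i v c u w; rewrite /alt_sum mulr_sumr -big_split.
apply: eq_bigr => s _.
have sE t : (fun l => [eta v with i |-> t] (s l)) =
            [eta (fun l => v (s l)) with (s^-1)%g i |-> t].
  by apply/funext => l /=; rewrite -(inj_eq (@perm_inj _ s)) permKV.
by rewrite !sE am mulrDr [LHS]addrC mulrCA addrC.
Qed.

(** Polarization: expand [a] with the sum of two arguments in both places. *)
Lemma alternating_tperm k (a : ('I_k -> V) -> R) i j x :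
  Defs.multilinear a -> Defs.alternating a -> i != j ->
  a (fun l => x (tperm i j l)) = - a x.
Proof.
move=> am aa ij.
pose G p q := a [eta [eta x with i |-> p] with j |-> q].
have Gpp p : G p p = 0 by apply: (aa i j) => //=; rewrite !eqxx (negbTE ij).
have GDr p q q' : G p (q + q') = G p q + G p q'.
  by have := am j [eta x with i |-> p] 1 q q'; rewrite scale1r mul1r.
have GDl p p' q : G (p + p') q = G p q + G p' q.
  have GE t : G t q = a [eta [eta x with j |-> q] with i |-> t].
    rewrite /G; congr a; apply/funext => l /=.
    by case: (eqVneq l j) => [->|//]; rewrite eq_sym (negbTE ij).
  by have := am i [eta x with j |-> q] 1 p p'; rewrite scale1r mul1r -!GE.
have := Gpp (x i + x j); rewrite GDl !GDr !Gpp add0r addr0 => /eqP.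
rewrite addrC addr_eq0 => /eqP GN.
have -> : a x = G (x i) (x j).
  congr a; apply/funext => l /=.
  by case: (eqVneq l j) => [->//|_]; case: (eqVneq l i) => [->|].
rewrite -GN; congr a; apply/funext => l /=.
case: tpermP => [->|->|/eqP/negbTE -> /eqP/negbTE ->//].
  by rewrite eqxx (negbTE ij).
by rewrite eqxx.
Qed.

(** For a multilinear form this says that it descends to the quotient by [K]. *)
Definition vanishes_on k (K : set V) (a : ('I_k -> V) -> R) : Prop :=
  forall x i, K (x i) -> a x = 0.

(** The kernel is defined by the first slot; antisymmetry moves any other
    argument there. *)
Lemma ker_form_vanishes k (a : ('I_k.+1 -> V) -> R) :
  Defs.multilinear a -> Defs.alternating a -> vanishes_on _ (ker_form a) a.
Proof.
move=> am aa x i Kxi.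
have a0 (y : 'I_k.+1 -> V) : ker_form a (y ord0) -> a y = 0.
  by move=> /(congr1 (fun f => f (fun l => y (lift ord0 l))));
    rewrite /Defs.contraction fcons_eta.
have [i0|i0] := eqVneq i ord0; first by apply: a0; rewrite -i0.
rewrite -[a x]opprK -(alternating_tperm _ _ i ord0) // a0 ?oppr0 //.
by rewrite tpermR.
Qed.

Lemma tensor_vanishes p q (K : set V) (a : ('I_p -> V) -> R)
    (b : ('I_q -> V) -> R) :
  vanishes_on _ K a -> vanishes_on _ K b -> vanishes_on _ K (tensor a b).
Proof.
move=> aK bK x i; rewrite /tensor; case: (split_ordP i) => j -> Kx.
  by rewrite (aK _ j) ?mul0r.
by rewrite (bK _ j) ?mulr0.
Qed.

Lemma tensor_pow_vanishes (K : set V) (w : ('I_2 -> V) -> R) r :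
  vanishes_on _ K w -> vanishes_on _ K (tensor_pow w r).
Proof.
by move=> wK; elim: r => [x []//|r IH]; exact: tensor_vanishes.
Qed.

Lemma alt_sum_vanishes k (K : set V) (a : ('I_k -> V) -> R) :
  vanishes_on _ K a -> vanishes_on _ K (alt_sum a).
Proof.
move=> aK x i Kx; apply: big1 => s _.
by rewrite (aK _ ((s^-1)%g i)) ?mulr0 ?permKV.
Qed.

Lemma scalar_sum (f : V -> R) k (c : 'I_k -> R) (x : 'I_k -> V) :
  scalar f -> f (\sum_i c i *: x i) = \sum_i c i * f (x i).
Proof.
move=> fl.
have f0 : f 0 = 0.
  by have := fl (-1) 0 0; rewrite scaler0 addr0 mulN1r addNr.
apply: (big_ind2 (fun u a => f u = a)) => // [u a v b <- <-|i _].
  by have := fl 1 u v; rewrite scale1r mul1r.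
by rewrite -[c i *: _]addr0 fl f0 addr0.
Qed.

(** If the family is free, its span meets [K] by the dimension formula. *)
Lemma dependent_modulo k (x : 'I_k -> V) (K : {vspace V}) :
  (\dim {: V} < k + \dim K)%N ->
  exists c : 'I_k -> R, (exists j, c j != 0) /\ \sum_i c i *: x i \in K.
Proof.
move=> dimK; pose X := [tuple x i | i < k].
have XE (i : 'I_k) : X`_i = x i by rewrite -tnth_nth tnth_mktuple.
have [Xfree|] := boolP (free X); last first.
  move=> /(elimN freeP) Xnfree; apply: contrapT => Nc; apply: Xnfree => c c0 i.
  apply: contrapT => /eqP ci; apply: Nc; exists c; split; first by exists i.
  by under eq_bigr do rewrite -XE; rewrite c0 mem0v.
have dimX : \dim <<X>> = k by move: Xfree; rewrite /free size_tuple => /eqP.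
have capN0 : (<<X>> :&: K)%VS != 0%VS.
  rewrite -dimv_eq0 -lt0n -(ltn_add2l (\dim (<<X>> + K))) addn0.
  by rewrite dimv_sum_cap dimX (leq_ltn_trans _ dimK)// dimvS ?subvf.
set y := vpick (<<X>> :&: K).
have /memv_capP[yX yK] : y \in (<<X>> :&: K)%VS := memv_pick _.
exists (fun i => coord X i y); split.
  apply: contrapT => Nj; move: capN0; rewrite -vpick0 -/y (coord_span yX) => /eqP.
  apply; apply: big1 => i _.
  have [->|ci] := eqVneq (coord X i y) 0; first by rewrite scale0r.
  by case: Nj; exists i.
by under eq_bigr do rewrite -XE; rewrite -(coord_span yX).
Qed.

(** A form that descends to a quotient of dimension less than its degree is
    zero: one argument can be replaced by a combination of all of them that
    lies in [K], and only its own coefficient matters by alternation. *)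
Lemma alternating_eq0_codim k (a : ('I_k -> V) -> R) (K : {vspace V}) :
  Defs.multilinear a -> Defs.alternating a ->
  vanishes_on _ [set` K]%classic a ->
  (\dim {: V} < k + \dim K)%N -> a = 0.
Proof.
move=> am aa aK dimK; apply/funext => x.
have [c [[j cj] cK]] := dependent_modulo _ x K dimK.
have : a [eta x with j |-> \sum_i c i *: x i] = 0.
  by apply: (aK _ j); rewrite /= eqxx.
rewrite (scalar_sum _ _ c x (am j x)) (bigD1 j) //= big1 => [|i ij].
  rewrite addr0 => /eqP; rewrite mulf_eq0 (negbTE cj) /= => /eqP ax0.
  rewrite -[RHS]/(0 : R) -[RHS]ax0.
  by congr a; apply/funext => l /=; case: eqVneq => [->|].
by rewrite (aa i j) ?mulr0 //= eqxx (negbTE ij).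
Qed.

(** Rank-nullity on [K0] for the linear map to R^m with components [l i]. *)
Lemma dim_common_zeros m (l : 'I_m -> V -> R) (K0 K : {vspace V}) :
  (forall i, scalar (l i)) ->
  (forall v, v \in K0 -> (forall i, l i v = 0) -> v \in K) ->
  (\dim K0 <= \dim K + m)%N.
Proof.
move=> ll lK; pose f v : 'rV[R]_m := \row_i l i v.
have fl : linear f by move=> c u v; apply/rowP => i; rewrite !mxE ll.
pose F : {linear V -> 'rV[R]_m} := HB.pack f (GRing.isLinear.Build _ _ _ _ f fl).
rewrite -(limg_ker_dim (linfun F) K0); apply: leq_add.
  apply/dimvS/subvP => v /memv_capP[vK0]; rewrite memv_ker lfunE /= => /eqP fv0.
  by apply: lK => // i; move/rowP : fv0 => /(_ i); rewrite !mxE.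
by rewrite (leq_trans (dimvS (subvf _)))// dimvf /dim /= mul1n.
Qed.

End VanishingForms.

(** * Exterior powers of a 2-form *)

Section TwoForms.
Context {R : realType} {V : vectType R}.
Context (w : ('I_2 -> V) -> R).
Context (wm : Defs.multilinear w) (wa : Defs.alternating w).

(** The permutations that fix [tensor_pow w r.+1] up to their sign act
    transitively: they include the exchange of the two indices of the first
    factor and, since scalars commute, the exchange of the first two factors,
    an even permutation. Hence one may always assume that a given argument
    stands first. *)
Lemma tensor_pow_transitive r (j : 'I_(r.+1 * 2)) :
  exists2 g : 'S_(r.+1 * 2), g j = ord0 &
    forall x, (-1) ^+ g * tensor_pow w r.+1 (fun i => x (g i)) =
              tensor_pow w r.+1 x.
Proof.
have I2 (k : 'I_2) : k = 0 \/ k = 1.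
  by case: k => [[|[|//]] k2]; [left|right]; exact: val_inj.
(* Exchanging the two indices of the first factor is an odd permutation, and
   it changes the sign of the value because [w] is antisymmetric. *)
have first_pair r' (k : 'I_2) : exists2 g : 'S_(r'.+1 * 2),
    g (lshift (r' * 2) k) = ord0 &
    forall x, (-1) ^+ g * tensor_pow w r'.+1 (fun i => x (g i)) =
              tensor_pow w r'.+1 x.
  pose e l : 'I_(r'.+1 * 2) := lshift (r' * 2) (l : 'I_2).
  case: (I2 k) => ->.
    exists 1%g => [|x]; first by rewrite perm1; exact: val_inj.
    rewrite odd_perm1 mul1r; congr (tensor_pow w r'.+1 _).
    by apply/funext => i; rewrite perm1.
  exists (tperm (e 0) (e 1)) => [|x]; first by rewrite tpermR; exact: val_inj.
  have e01 : e 0 != e 1 by apply/negbT; exact: (@eq_lshift 2 _ 0 1).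
  rewrite odd_tperm e01 expr1 mulN1r /= /tensor -mulNr.
  have e_inj : injective e by exact: (@lshift_inj 2).
  have -> : (fun i => x (tperm (e 0) (e 1) (e i))) =
            (fun i => x (e (tperm 0 1 i))).
    by apply/funext => i; rewrite inj_tperm.
  rewrite (alternating_tperm _ w 0 1 (fun i => x (e i)))// opprK.
  congr (_ * tensor_pow w r' _); apply/funext => i.
  by rewrite tpermD //; apply/negbT; exact: (@eq_lrshift 2).
(* An index of a later factor is brought to the second factor by induction,
   and then to the first by the exchange [h] of these two factors. *)
elim: r j => [|r IH] j; case: (split_ordP (j : 'I_(2 + _))) => j' -> {j}.
- exact: first_pair.
- by case: j'.
- exact: first_pair.
pose e k : 'I_(r.+2 * 2) := lshift (r.+1 * 2) (k : 'I_2).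
pose f k : 'I_(r.+2 * 2) := rshift 2 (lshift (r * 2) (k : 'I_2)).
pose f' k : 'I_(r.+2 * 2) := rshift 2 (rshift 2 (k : 'I_(r * 2))).
have ef k l : e k != f l by apply/negbT; exact: (@eq_lrshift 2).
have fe k l : f k != e l by rewrite eq_sym ef.
have ee k l : (e k == e l) = (k == l).
  exact: (@eq_lshift 2).
have ff k l : (f k == f l) = (k == l).
  by rewrite -(@eq_lshift 2 (r * 2)); exact: (@eq_rshift 2).
have ef' k l : e k != f' l by apply/negbT; exact: (@eq_lrshift 2).
have ff' k l : f k != f' l.
  apply/negP => /eqP/(@rshift_inj 2)/eqP; apply/negP/negbT.
  exact: (@eq_lrshift 2).
pose h := (tperm (e 0) (f 0) * tperm (e 1%R) (f 1%R))%g.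
have he k : h (e k) = f k.
  case: (I2 k) => ->; rewrite permM.
    by rewrite tpermL tpermD ?ef ?ff//.
  by rewrite [tperm (e 0) _ _]tpermD ?tpermL ?fe ?ee.
have hf k : h (f k) = e k.
  case: (I2 k) => ->; rewrite permM.
    by rewrite tpermR tpermD ?fe ?ee.
  by rewrite [tperm (e 0) _ _]tpermD ?tpermR ?ef ?ff.
have hf' k : h (f' k) = f' k by rewrite permM [tperm (e 0) _ _]tpermD // tpermD.
have hT x : tensor_pow w r.+2 (fun i => x (h i)) = tensor_pow w r.+2 x.
  rewrite /= /tensor mulrCA; congr (w _ * (w _ * tensor_pow w r _));
    apply/funext => i; [exact: (congr1 x (hf i))|exact: (congr1 x (he i))|].
  exact: (congr1 x (hf' i)).
have [g gj gT] := IH j'.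
have Gj : shift_perm 2 g (rshift 2 j') = f 0.
  by rewrite [LHS](shift_perm_rshift 2 _ g) gj; congr (rshift 2 _); exact: val_inj.
exists (shift_perm 2 g * h)%g => [|x].
  rewrite permM Gj hf; exact: val_inj.
have -> : odd_perm (shift_perm 2 g * h) = odd_perm g.
  by rewrite odd_permM odd_shift_perm /h odd_permM !odd_tperm !ef addbb addbF.
rewrite -[RHS]hT -[tensor_pow w r.+2]/(tensor w (tensor_pow w r.+1)) /tensor.
rewrite mulrCA.
congr (w _ * _).
  apply/funext => i; rewrite permM; congr (x (h _)).
  exact: (shift_perm_lshift 2 _ g).
rewrite -[RHS]gT; congr (_ * tensor_pow w r.+1 _).
apply/funext => i; rewrite permM; congr (x (h _)).
exact: (shift_perm_rshift 2 _ g).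
Qed.

(** If [v] is w-orthogonal to all of [y], then [v] can only be paired with
    [u]. By [tensor_pow_transitive] the [r.+1 * 2] possible positions of [v]
    contribute equally, and with [v] in front the sum is that of the 1-form
    w(v, _) against [tensor_pow w r]. *)
Lemma alt_sum_tensor_pow_fcons r v u (y : 'I_(r * 2) -> V) :
  (forall i, Defs.contraction v w (fun=> y i) = 0) ->
  alt_sum (tensor_pow w r.+1) (fcons v (fcons u y)) =
  (r.+1 * 2)%:R * (Defs.contraction v w (fun=> u) * alt_sum (tensor_pow w r) y).
Proof.
move=> vy.
have -> : Defs.contraction v w (fun=> u) * alt_sum (tensor_pow w r) y =
    alt_sum (Defs.contraction v (tensor_pow w r.+1 : ('I_(r * 2).+2 -> V) -> R))
      (fcons u y).
  rewrite -(alt_sum_tensor1 _ (Defs.contraction v w)).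
    congr (alt_sum _ _); apply/funext => z; rewrite /tensor /Defs.contraction /=.
    congr (w _ * tensor_pow w r _); apply/funext => i.
      case: (unliftP ord0 i) => [i'|] ->; rewrite ?fcons_lift ?fcons0.
        by rewrite lshift_lift0 fcons_lift.
      by rewrite [lshift _ _](_ : _ = ord0) ?fcons0//; exact: val_inj.
    by rewrite (rshift_lift0 1) fcons_lift.
  move=> s; case: (unliftP ord0 (s ord0)) => [k sk _|->]; last by rewrite eqxx.
  rewrite /tensor (_ : (fun i => _) = (fun=> y k)) ?vy ?mul0r//.
  apply/funext => i; rewrite ord1 [lshift _ _](_ : _ = ord0) ?sk ?fcons_lift //.
  exact: val_inj.
(* Split the sum according to the position [j] of [v]. *)
rewrite -alt_sum_fix0 {1}/alt_sum.
rewrite (partition_big (fun s : 'S_(r.+1 * 2) => (s^-1)%g ord0) xpredT) //=.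
rewrite mulr_natl -[in RHS](card_ord (r.+1 * 2)) -sumr_const.
apply: eq_bigr => j _; have [g gj gT] := tensor_pow_transitive r j.
rewrite (reindex_inj (mulgI g)).
apply: eq_big => [s|s _].
  by rewrite -(inj_eq (@perm_inj _ (g * s)%g)) permKV permM gj eq_sym.
transitivity ((-1) ^+ s * ((-1) ^+ g *
  tensor_pow w r.+1 (fun i => fcons v (fcons u y) (s (g i))))).
  rewrite odd_permM signr_addb mulrA [_ ^+ s * _]mulrC.
  by congr (_ * tensor_pow w r.+1 _); apply/funext => i; rewrite permM.
by rewrite (gT (fun i => fcons v (fcons u y) (s i))).
Qed.

End TwoForms.

(** * The class of a pair of forms on a vector space *)

Section Class.
Context {R : realType} {V : vectType R}.
Context (t : ('I_1 -> V) -> R) (w : ('I_2 -> V) -> R).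
Context (tm : Defs.multilinear t) (ta : Defs.alternating t).
Context (wm : Defs.multilinear w) (wa : Defs.alternating w).

Lemma contraction_scalar k (a : ('I_k.+1 -> V) -> R) u :
  Defs.multilinear a -> scalar (fun v => Defs.contraction v a u).
Proof.
by move=> am c v v'; rewrite /Defs.contraction fcons_with am -!fcons_with.
Qed.

Lemma wedge_pow_eq0 r x :
  (wedge_pow w r x == 0) = (alt_sum (tensor_pow w r) x == 0).
Proof. by rewrite wedge_powE mulf_eq0 expf_eq0 invr_eq0 pnatr_eq0 andbF. Qed.

(** If w(v, y) were nonzero for some [y], then w^(r+1)(v, y, u) would be
    a nonzero multiple of w(v, y) w^r(u). *)
Lemma ker_of_top_power r u v :
  wedge_pow w r.+1 = 0 -> wedge_pow w r u != 0 ->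
  (forall i, Defs.contraction v w (fun=> u i) = 0) -> ker_form w v.
Proof.
rewrite wedge_pow_eq0 => wr1 wr vu; apply/funext => y.
have -> : y = fun=> y ord0 by apply/funext => i; rewrite ord1.
have : wedge_pow w r.+1 (fcons v (fcons (y ord0) u)) == 0 by rewrite wr1.
rewrite wedge_pow_eq0 alt_sum_tensor_pow_fcons //.
by rewrite !mulf_eq0 pnatr_eq0 (negbTE wr) orbF => /eqP.
Qed.

Definition ker_w : {vspace V} := vspace_of_set (ker_form w).
Definition ker_pair : {vspace V} := vspace_of_set (ker_form t `&` ker_form w)%classic.

Lemma mem_ker_w v : v \in ker_w <-> ker_form w v.
Proof. by have [? ?] := ker_form_submod wm; exact: vspace_of_setP. Qed.

Lemma mem_ker_pair v : v \in ker_pair <-> ker_form t v /\ ker_form w v.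
Proof.
have [w0 wS] := ker_form_submod wm; have [t0 tS] := ker_form_submod tm.
apply: (@vspace_of_setP _ _ (ker_form t `&` ker_form w)%classic) => //.
by move=> c x y [? ?] [? ?]; split; [exact: tS|exact: wS].
Qed.

Lemma wedge_pow_neq0_dim r : wedge_pow w r <> 0 -> (r * 2 + \dim ker_w <= \dim {:V})%N.
Proof.
move=> wr0; rewrite leqNgt; apply/negP => dimK; apply: wr0.
apply/funext => x; apply/eqP; rewrite wedge_pow_eq0; apply/eqP.
have -> // : alt_sum (tensor_pow w r) = 0.
apply: (alternating_eq0_codim _ _ ker_w) dimK.
- exact/alt_sum_multilinear/tensor_pow_multilinear.
- exact: alt_sum_alternating.
- apply/alt_sum_vanishes/tensor_pow_vanishes => y i /mem_ker_w.
  exact: ker_form_vanishes.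
Qed.

Lemma wedge_tensor_pow_eq0 r x :
  (wedge t (wedge_pow w r) x == 0) =
  (alt_sum (tensor t (tensor_pow w r)) x == 0).
Proof.
by rewrite wedge_tensor_pow !mulf_eq0 expf_eq0 !invr_eq0 !pnatr_eq0 andbF.
Qed.

Lemma wedge_neq0_dim r :
  wedge t (wedge_pow w r) <> 0 -> ((r * 2).+1 + \dim ker_pair <= \dim {:V})%N.
Proof.
move=> wr0; rewrite leqNgt; apply/negP => dimK; apply: wr0.
apply/funext => x; apply/eqP; rewrite wedge_tensor_pow_eq0; apply/eqP.
have -> // : alt_sum (tensor t (tensor_pow w r)) = 0.
apply: (alternating_eq0_codim _ _ ker_pair) dimK.
- apply: alt_sum_multilinear; apply: (tensor_multilinear 1) => //.
  exact: tensor_pow_multilinear.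
- exact: alt_sum_alternating.
- apply: alt_sum_vanishes; apply: (tensor_vanishes 1);
    last apply: tensor_pow_vanishes.
    by move=> y i /mem_ker_pair[? _]; apply: (ker_form_vanishes _ _ _ _ _ i).
  by move=> y i /mem_ker_pair[_]; exact: ker_form_vanishes.
Qed.

(** The lower bound on the dimension of the kernel comes from the [r * 2]
    equations w(_, u_i) = 0, where w^r(u) is nonzero; the upper bound is
    [wedge_pow_neq0_dim]. *)
Lemma dim_ker_top_power r : wedge_pow w r.+1 = 0 -> wedge_pow w r <> 0 ->
  (\dim {:V} = \dim ker_w + r * 2)%N.
Proof.
move=> wr1 wr; apply/eqP; rewrite eqn_leq; apply/andP; split;
  last by rewrite addnC wedge_pow_neq0_dim.
have [u wru] : exists u, wedge_pow w r u != 0.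
  apply: contrapT => Nu; apply: wr; apply/funext => u; apply/eqP.
  by apply/negPn/negP => wru; apply: Nu; exists u.
apply: (dim_common_zeros _ (fun i v => Defs.contraction v w (fun=> u i))).
  by move=> i; exact: contraction_scalar.
by move=> v _ vu; apply/mem_ker_w; exact: (ker_of_top_power r u).
Qed.

Lemma ker_form1 v : ker_form t v <-> t (fun=> v) = 0.
Proof.
have E u : Defs.contraction v t u = t (fun=> v).
  by congr t; apply/funext => i; rewrite ord1 fcons0.
by split => [/(congr1 (fun f => f (fun=> v)))|tv0]; [rewrite E|apply/funext=> u; rewrite E].
Qed.

Lemma ker_pair_sub : (ker_pair <= ker_w)%VS.
Proof. by apply/subvP => v /mem_ker_pair[_ ?]; apply/mem_ker_w. Qed.

Lemma dim_ker_pair : (\dim ker_w <= \dim ker_pair + 1)%N.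
Proof.
apply: (dim_common_zeros _ (fun (_ : 'I_1) v => Defs.contraction v t (fun=> 0))).
  by move=> i; exact: contraction_scalar.
move=> v /mem_ker_w vw /(_ ord0) tv; apply/mem_ker_pair; split=> //.
by apply/funext => y; apply: etrans tv; congr (Defs.contraction v t _); apply/funext => -[].
Qed.

(** Large powers vanish by [wedge_pow_neq0_dim], and the zeroth is 1. *)
Lemma max_wedge_pow : exists2 r, wedge_pow w r.+1 = 0 & wedge_pow w r <> 0.
Proof.
pose P r := `[< wedge_pow w r <> 0 >].
have P0 : exists r, P r.
  exists 0%N; apply/asboolP => /(congr1 (fun f => f (fun=> 0))) /eqP.
  by rewrite /= oner_eq0.
have Pub r : P r -> (r <= \dim {:V})%N.
  move=> /asboolP/wedge_pow_neq0_dim; apply: leq_trans.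
  by rewrite (leq_trans _ (leq_addr _ _))// muln2 -addnn leq_addr.
have [r /asboolP Pr rmax] := ex_maxnP P0 Pub.
exists r => //; apply: contrapT => wr1.
have Pr1 : P r.+1 by apply/asboolP.
by have := rmax _ Pr1; rewrite ltnn.
Qed.

Lemma codim_oddP r :
  codim (ker_form t `&` ker_form w)%classic = (2 * r + 1)%N <->
  wedge_pow w r.+1 = 0 /\ wedge t (wedge_pow w r) <> 0.
Proof.
rewrite /codim -/ker_pair mulnC addn1; split; last first.
  move=> [wr1 twr].
  have wr : wedge_pow w r <> 0.
    move=> wr; apply: twr; apply/funext => x.
    by rewrite /wedge wr big1 ?mulr0// => s _; rewrite mulr0.
  have dV := dim_ker_top_power _ wr1 wr; have le_dK := dim_ker_pair.
  (* The kernel of [t] cuts that of [w] by at most one dimension, and the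
     degree of the nonzero form bounds the class from below. *)
  apply/eqP; rewrite eqn_leq; apply/andP; split.
    by rewrite leq_subLR dV addnS -addSn leq_add2r -addn1.
  by rewrite leq_subRL ?dimvS ?subvf// addnC wedge_neq0_dim.
move=> dVt; have [s ws1 ws] := max_wedge_pow.
have dV := dim_ker_top_power _ ws1 ws; have le_dK := dim_ker_pair; have sub_dK := dimvS ker_pair_sub.
(* The class is [s * 2] or [s * 2 + 1], and it is odd. *)
have sr : s = r.
  have : (s * 2 + (\dim ker_w - \dim ker_pair) = (r * 2).+1)%N.
    by rewrite -dVt dV addnBA // addnC.
  have : (\dim ker_w - \dim ker_pair <= 1)%N by rewrite leq_subLR.
  case: (_ - _)%N => [|[|//]] _; rewrite ?addn0 ?addn1 => /eqP.
    by move=> /eqP/(congr1 odd); rewrite /= !oddM !andbF.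
  by rewrite eqSS eqn_pmul2r // => /eqP.
rewrite {s}sr in ws1 ws dV; split=> //.
have [v vw tv] : exists2 v, ker_form w v & t (fun=> v) <> 0.
  apply: contrapT => Nv; have ker_eq : ker_pair = ker_w.
    apply/eqP; rewrite eqEsubv ker_pair_sub; apply/subvP => v /mem_ker_w vw.
    apply/mem_ker_pair; split=> //; apply/ker_form1; apply: contrapT => tv.
    by apply: Nv; exists v.
  by move/eqP: dVt; rewrite ker_eq dV addKn eqn_leq ltnn andbF.
(* With [v] in the kernel of [w], (t /\ w^r)(v, u) is a nonzero multiple of
   t(v) w^r(u). *)
move=> twr; apply: ws; apply/funext => u; apply/eqP; rewrite wedge_pow_eq0.
have : wedge t (wedge_pow w r) (fcons v u) == 0 by rewrite twr.
rewrite wedge_tensor_pow_eq0 alt_sum_tensor1 => [|s s0].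
  by rewrite mulf_eq0 => /orP[/eqP|].
rewrite /tensor; case: (unliftP ord0 ((s^-1)%g ord0)) => [i si|/eqP].
  rewrite (tensor_pow_vanishes _ _ _ (ker_form_vanishes _ _ wm wa) _ i) ?mulr0//.
  by rewrite rshift_lift0 (_ : rshift 0 i = i) -?si ?permKV ?fcons0//; exact: val_inj.
by rewrite -(inj_eq (@perm_inj _ s)) permKV eq_sym (negbTE s0).
Qed.
End Class.

Theorem proposition2p16 (R : realType) (n : nat) (M : smoothManifold R n)
    (tau : diff_form M 1) (omega : diff_form M 2) (r : nat) :
  doublet_of_class tau omega (2 * r + 1)%N <->
  (forall x : M, wedge_pow (omega x) r.+1 = 0 /\
                 wedge (tau x) (wedge_pow (omega x) r) <> 0).
Proof.
have pointwise x := codim_oddP (tau x) (omega x) (form_multilinear tau x)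
  (form_alternating tau x) (form_multilinear omega x) (form_alternating omega x) r.
by split=> H x; apply/pointwise; exact: H.
Qed.
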